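(* There are no $(3,2;+1)$-digraphs; that is, there is no $2$-geodetic digraph with minimum out-degree $3$ and order $1+3+3^2+1=14$.
   Context: Digraphs are finite and without multiple arcs. A digraph $G$ is $k$-geodetic if for any (not necessarily distinct) vertices $u,v$ there is at most one directed walk from $u$ to $v$ of length at most $k$ (walks of length $0$ count, so there are no directed cycles of length at most $k$). A $(d,k;+1)$-digraph is a $k$-geodetic digraph with minimum out-degree $d$ and order $M(d,k)+1$, where $M(d,k)=1+d+d^2+\dots+d^k$. It is known that every $(d,k;+1)$-digraph with $d,k\ge 2$ is diregular (all in-degrees and out-degrees equal $d$). *)

(* Defs.v *)
From mathcomp Require Import all_boot.

Set Implicit Arguments.
Unset Strict Implicit.
Unset Printing Implicit Defensive.

(* A finite digraph without multiple arcs is a relation [arc] on a finType;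
   loops are not excluded a priori, but no [k]-geodetic digraph with [0 < k]
   has one. *)

Definition outdeg (V : finType) (arc : rel V) (v : V) : nat :=
  #|[set w | arc v w]|.

Definition has_min_outdeg (V : finType) (arc : rel V) (d : nat) : Prop :=
  (forall v, d <= outdeg arc v) /\ (exists v, outdeg arc v = d).

(* As there are no multiple arcs, a directed walk is determined by its sequence
   of vertices [u :: p]; its length is then [size p]. *)
Definition walk (V : finType) (arc : rel V) (u v : V) (p : seq V) : Prop :=
  path arc u p /\ last u p = v.

Definition geodetic (V : finType) (arc : rel V) (k : nat) : Prop :=
  forall (u v : V) (p q : seq V),
    walk arc u v p -> size p <= k ->
    walk arc u v q -> size q <= k ->
    p = q.

Definition moore_bound (d k : nat) : nat := \sum_(i < k.+1) d ^ i.

(* The digraphs usually denoted (d,k;+1). *)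
Definition excess_one_digraph (d k : nat) (V : finType) (arc : rel V) : Prop :=
  [/\ geodetic arc k, has_min_outdeg arc d & #|V| = moore_bound d k + 1].

(* Main.v *)
Require Import Defs.
From mathcomp Require Import all_boot.

(** Counting the out-tree of depth two of a vertex shows that all out-degrees
    are three, so such a tree together with one further vertex labels the
    vertices by 0, ..., 13, the first four rows of the adjacency matrix being
    known. In a 2-geodetic digraph adjacent vertices have disjoint
    out-neighbourhoods, and so have distinct out-neighbours of a common vertex.
    With these constraints propagated after every choice of a row, a backtracking
    search for the other rows fails after about a thousand steps. *)

Set Implicit Arguments.
Unset Strict Implicit.
Unset Printing Implicit Defensive.

(** * Rows of an adjacency matrix as bit sequences *)

Fixpoint disj (s t : bitseq) : bool :=
  match s, t with
  | x :: s', y :: t' => if x && y then false else disj s' t'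
  | _, _ => true
  end.

Lemma disjPn (s t : bitseq) :
  ~~ disj s t -> exists i, nth false s i && nth false t i.
Proof.
elim: s t => [|x s IHs] [|y t] //=; case: ifP => [xy _|_ /IHs[i]]; first by exists 0.
by exists i.+1.
Qed.

Lemma disjC (s t : bitseq) : disj s t = disj t s.
Proof. by elim: s t => [|a s IHs] [|b t] //=; rewrite andbC IHs. Qed.

Fixpoint choose_bits (n k : nat) : seq bitseq :=
  match n with
  | 0 => if k is 0 then [:: [::]] else [::]
  | n'.+1 =>
      (if k is k'.+1 then map (cons true) (choose_bits n' k') else [::])
      ++ map (cons false) (choose_bits n' k)
  end.

Lemma mem_choose_bits (n k : nat) (s : bitseq) :
  size s = n -> count id s = k -> s \in choose_bits n k.
Proof.
move=> <- <-; elim: s => [|[] s IHs] //=; rewrite mem_cat; apply/orP.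
  by left; apply: map_f.
by right; apply: map_f.
Qed.

(** * Backtracking search with constraint propagation *)

Definition labelled_row := (nat * bitseq)%type.
Definition row_domain := (nat * seq bitseq)%type.

(* Rows from which row [v] must be disjoint once row [u] is known to be [S], as
   far as the disjointness is not implied by [rows] alone. *)
Definition must_avoid (rows : seq labelled_row) (u : nat) (S : bitseq) (v : nat) :
    seq bitseq :=
  if nth false S v then
    S :: [seq r.2 | r <- rows & (r.1 != v) && nth false S r.1]
  else if (u != v) && has (fun r => nth false r.2 u && nth false r.2 v) rows
  then [:: S] else [::].

(** A known vertex whose row meets [S] cannot share an in-neighbour with [u], since distinct
    out-neighbours of one vertex have disjoint rows. *)
Definition not_siblings (rows : seq labelled_row) (u : nat) (S : bitseq) : seq nat :=
  [seq r.1 | r <- rows & (r.1 != u) && ~~ disj r.2 S].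

(** The implication treats an arc from [v] to [u]: it must not close a 2-cycle, its ends have
    disjoint rows, and no other out-neighbour of [v] may have a row meeting [S]. *)
Definition compatible (avoid : seq bitseq) (nosib : seq nat)
    (u : nat) (S : bitseq) (v : nat) (T : bitseq) : bool :=
  all (disj T) avoid &&
  (nth false T u ==>
     [&& ~~ nth false S v, disj T S & all (fun y => ~~ nth false T y) nosib]).

Definition restrict (rows : seq labelled_row) (u : nat) (S : bitseq)
    (doms : seq row_domain) : seq row_domain :=
  let nosib := not_siblings rows u S in
  [seq (d.1, let avoid := must_avoid rows u S d.1 in
             [seq T <- d.2 | compatible avoid nosib u S d.1 T]) | d <- doms].

(** Running out of fuel or of domains yields [false], so neither can pass for a refutation. *)
Fixpoint refuted (fuel : nat) (rows : seq labelled_row) (doms : seq row_domain) :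
    bool :=
  if fuel is fuel'.+1 then
    if doms is (u, D) :: doms' then
      all (fun S =>
             let doms'' := restrict rows u S doms' in
             if has (fun d => nilp d.2) doms'' then true
             else refuted fuel' ((u, S) :: rows) doms'') D
    else false
  else false.

Definition block (m k n : nat) : bitseq :=
  nseq m false ++ nseq k true ++ nseq n false.

(** Label 0 is the root, with out-neighbours 1, 2, 3; theirs are 4 to 6, 7 to 9 and 10 to 12, and 13
    lies outside the tree. A row not fixed by the tree may be any loopless row of weight three. *)
Definition initial_domains : seq row_domain :=
  [:: (0, [:: block 1 3 10]); (1, [:: block 4 3 7]);
      (2, [:: block 7 3 4]); (3, [:: block 10 3 1])]
  ++ [seq (v, [seq T <- choose_bits 14 3 | ~~ nth false T v]) | v <- iota 4 10].

Lemma initial_domains_refuted : refuted 14 [::] initial_domains.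
Proof. by vm_compute. Qed.

(** * Constraints forced by 2-geodecity *)

Section TwoGeodetic.

Variables (V : finType) (arc : rel V).
Hypothesis geo : geodetic arc 2.

Lemma geodetic2_irr u : ~~ arc u u.
Proof.
apply/negP=> uu; have := @geo u u [::] [:: u]; rewrite /walk /= uu.
by move=> /(_ (conj isT erefl) isT (conj isT erefl) isT).
Qed.

Lemma geodetic2_asym u v : arc u v -> ~~ arc v u.
Proof.
move=> uv; apply/negP=> vu; have := @geo u u [::] [:: v; u].
by rewrite /walk /= uv vu => /(_ (conj isT erefl) isT (conj isT erefl) isT).
Qed.

Lemma geodetic2_disj_adjacent u v w : arc u v -> arc u w -> ~~ arc v w.
Proof.
move=> uv uw; apply/negP=> vw; have := @geo u w [:: w] [:: v; w].
by rewrite /walk /= uv uw vw => /(_ (conj isT erefl) isT (conj isT erefl) isT).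
Qed.

Lemma geodetic2_disj_siblings u v w x :
  arc u v -> arc u w -> arc v x -> arc w x -> v = w.
Proof.
move=> uv uw vx wx; have := @geo u x [:: v; x] [:: w; x].
rewrite /walk /= uv uw vx wx.
by move=> /(_ (conj isT erefl) isT (conj isT erefl) isT) [].
Qed.

(** * Soundness of the search *)

Section Labelling.

Variable L : seq V.
Hypothesis uniqL : uniq L.

Definition adj_row (x0 : V) (i : nat) : bitseq := map (arc (nth x0 L i)) L.

Variable x0 : V.
Local Notation row := (adj_row x0).
Local Notation x := (nth x0 L).

Lemma nth_adj_row i j : nth false (row i) j -> j < size L /\ arc (x i) (x j).
Proof.
have [lt_j|le_j] := ltnP j (size L); last by rewrite nth_default // size_map.
by rewrite (nth_map x0).
Qed.

Lemma disj_adj_row i j :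
  (forall w, arc (x i) w -> arc (x j) w -> False) -> disj (row i) (row j).
Proof.
move=> noc; apply/negPn/negP=> /disjPn[k /andP[/nth_adj_row[_ ik] /nth_adj_row[_ jk]]].
exact: noc ik jk.
Qed.

Lemma disj_adj_row_arc i j : nth false (row i) j -> disj (row j) (row i).
Proof.
move=> /nth_adj_row[_ ij]; apply: disj_adj_row => w jw iw.
by have /negP := geodetic2_disj_adjacent ij iw.
Qed.

Lemma disj_adj_row_siblings k i j :
  nth false (row k) i -> nth false (row k) j -> i != j -> disj (row i) (row j).
Proof.
move=> /nth_adj_row[lt_i ki] /nth_adj_row[lt_j kj] /eqP neq_ij.
apply: disj_adj_row => w iw jw; apply: neq_ij; apply/eqP.
by rewrite -(nth_uniq x0 lt_i lt_j uniqL) (geodetic2_disj_siblings ki kj iw jw).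
Qed.

Definition valid_rows (rows : seq labelled_row) := all (fun r => r.2 == row r.1) rows.
Definition valid_doms (doms : seq row_domain) := all (fun d => row d.1 \in d.2) doms.

(** Each test is an instance of asymmetry or of one of the two disjointness constraints, so pruning
    never discards an actual row. *)
Lemma compatible_adj_row rows u v : valid_rows rows ->
  compatible (must_avoid rows u (row u) v) (not_siblings rows u (row u))
    u (row u) v (row v).
Proof.
move=> /allP ok; apply/andP; split.
  rewrite /must_avoid; case: ifP => [uv /=|_].
    rewrite disj_adj_row_arc //=; apply/allP=> _ /mapP[r + ->].
    rewrite mem_filter eq_sym => /andP[/andP[neq ur] /ok/eqP ->].
    exact: disj_adj_row_siblings uv ur neq.
  case: ifP => //= /andP[neq /hasP[r /ok/eqP -> /andP[ru rv]]].
  by rewrite andbT disjC (disj_adj_row_siblings ru rv neq).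
apply/implyP=> vu; apply/and3P; split.
- apply/negP=> /nth_adj_row[_]; apply/negP/geodetic2_asym.
  by case: (nth_adj_row vu).
- by rewrite disjC disj_adj_row_arc.
- apply/allP=> _ /mapP[r + ->]; rewrite mem_filter => /andP[/andP[neq + /ok/eqP Er]].
  by rewrite Er; apply: contra => vr; apply: disj_adj_row_siblings vr vu neq.
Qed.

Lemma valid_restrict rows u doms : valid_rows rows -> valid_doms doms ->
  valid_doms (restrict rows u (row u) doms).
Proof.
move=> ok okd; rewrite /valid_doms all_map; apply: sub_all okd => d /= dP.
by rewrite mem_filter compatible_adj_row.
Qed.

(** Follow the branch that always chooses the actual row: every remaining domain keeps its actual
    row, so none becomes empty and the branch is never refuted. *)
Lemma refuted_sound fuel rows doms :
  valid_rows rows -> valid_doms doms -> ~~ refuted fuel rows doms.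
Proof.
elim: fuel rows doms => [|fuel IH] rows [|[u D] doms] //= ok /andP[/= uD okd].
have okd' := valid_restrict u ok okd.
apply/allPn; exists (row u) => //; case: ifP => [/hasP[d dP /nilP d0]|_].
  by have := allP okd' _ dP; rewrite d0.
by apply: IH => //=; rewrite eqxx.
Qed.

End Labelling.

(** * The out-tree of depth two as a labelling *)

Lemma uniq_out_tree u :
  uniq (u :: enum (arc u) ++ flatten [seq enum (arc v) | v <- enum (arc u)]).
Proof.
pose N v := enum (arc v); rewrite -!/(N _).
have mN v w : (w \in N v) = arc v w by rewrite mem_enum.
rewrite /= cat_uniq mem_cat mN negb_or geodetic2_irr enum_uniq /=.
apply/and3P; split.
- apply/negP=> /flatten_mapP[v]; rewrite !mN => uv.
  by apply/negP; apply: geodetic2_asym.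
- apply/hasPn=> w /flatten_mapP[v]; rewrite !mN => uv vw.
  by apply: contraL vw; apply: geodetic2_disj_adjacent.
(* Indexed by pairs, the second level has no repetition: a vertex reached through two out-neighbours
   of [u] would identify them. *)
have -> : flatten [seq N v | v <- N u] = [seq w | v <- N u, w <- N v].
  by congr flatten; apply: eq_map => v; rewrite map_id.
apply: allpairs_uniq_dep => [|v _|]; try exact: enum_uniq.
move=> _ _ /allpairsPdep[v [w [uv vw ->]]] /allpairsPdep[v' [w' [uv' vw' ->]]] /= Ew.
move: uv uv' vw vw'; rewrite !mN -Ew => uv uv' vw vw'.
by rewrite (geodetic2_disj_siblings uv uv' vw vw').
Qed.

End TwoGeodetic.

(** Used to read off the first four rows: in the labelling by the tree, these out-neighbourhoods are
    contiguous. *)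
Lemma map_mem_block (T : eqType) (s1 s2 s3 : seq T) : uniq (s1 ++ s2 ++ s3) ->
  map (mem s2) (s1 ++ s2 ++ s3) = block (size s1) (size s2) (size s3).
Proof.
rewrite uniq_catCA cat_uniq has_cat negb_or -!all_predC => /and3P[_ /andP[n1 n3] _].
have falses s : all (predC (mem s2)) s -> map (mem s2) s = nseq (size s) false.
  by elim: s => //= y s IHs /andP[/negbTE -> /IHs ->].
have trues s : {subset s <= s2} -> map (mem s2) s = nseq (size s) true.
  elim: s => //= y s IHs sub; rewrite sub ?mem_head // IHs // => z zs.
  by apply: sub; rewrite in_cons zs orbT.
by rewrite !map_cat (falses s1) // (falses s3) // trues.
Qed.

Lemma size_flatten_out_ge (V : finType) (arc : rel V) d (s : seq V) :
  (forall v, d <= outdeg arc v) ->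
  d * size s <= size (flatten [seq enum (arc v) | v <- s]).
Proof.
move=> min_out; elim: s => [|v s IHs] /=; first by rewrite muln0.
rewrite size_cat mulnS leq_add // -cardE -cardsE; exact: min_out.
Qed.

Theorem theorem4 (V : finType) (arc : rel V) : ~ excess_one_digraph 3 2 arc.
Proof.
case=> geo [min_out [u _]]; rewrite /moore_bound !big_ord_recr big_ord0 /= => cardV.
have {}cardV : #|V| = 14 by rewrite cardV.
pose N v := enum (arc v).
(* A fourth out-neighbour would give a tree with at least 1 + 4 + 3 * 4 > 14 vertices. *)
have sizeN v : size (N v) = 3.
  have le3k := size_flatten_out_ge (N v) min_out.
  have : size (v :: N v ++ flatten [seq N w | w <- N v]) <= 14.
    by rewrite -cardV -(card_uniqP (uniq_out_tree geo v)) max_card.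
  apply: contraTeq; rewrite neq_ltn -{1}cardE -cardsE ltnNge min_out /= => lt3.
  rewrite -ltnNge ltnS size_cat; apply: leq_trans (leq_add lt3 (leqnn _)).
  by rewrite (leq_add2l 4 10) (leq_trans _ le3k) // (leq_trans _ (leq_mul (leqnn 3) lt3)).
have [a [b [c Nu]]] : exists a b c, N u = [:: a; b; c].
  by case: (N u) (sizeN u) => [|a [|b [|c [|]]]] // _; exists a, b, c.
(* The tree is listed level by level, children in the order of their parents, as [initial_domains]
   presupposes; [z] will receive label 13. *)
pose t := [:: u; a; b; c] ++ N a ++ N b ++ N c.
have uniq_t : uniq t.
  by have := uniq_out_tree geo u; rewrite -/(N u) Nu /= cats0.
have size_t : size t = 13 by rewrite !size_cat !sizeN.
have [z zt] : exists z, z \notin t.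
  apply/existsP; rewrite -negb_forall; apply/negP=> /forallP all_t.
  have := uniq_leq_size (enum_uniq V) (fun w _ => all_t w).
  by rewrite -cardE cardV size_t.
pose L := t ++ [:: z].
have uniqL : uniq L by rewrite cat_uniq uniq_t /= orbF zt.
have size_L : size L = 14 by rewrite size_cat size_t.
have mem_L v : v \in L.
  have le_enum : size (enum V) <= size L by rewrite -cardE cardV size_L.
  by rewrite (uniq_min_size uniqL (fun w _ => mem_enum V w) le_enum).2 mem_enum.
have sum_row i : count id (adj_row arc L u i) = 3.
  rewrite count_map -(sizeN (nth u L i)) -size_filter; apply: perm_size.
  apply: uniq_perm => [||w]; [exact: filter_uniq|exact: enum_uniq|].
  by rewrite mem_filter mem_enum mem_L andbT.
have row_tree i s1 s3 : L = s1 ++ N (nth u L i) ++ s3 ->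
    adj_row arc L u i = block (size s1) 3 (size s3).
  move=> EL; rewrite -(sizeN (nth u L i)) -map_mem_block -?EL //.
  by apply: eq_map => w /=; rewrite mem_enum.
suff ok : valid_doms arc L u initial_domains.
  (* Domains and fuel are made variables so that the search is not evaluated a second time. *)
  move: initial_domains_refuted ok; move: initial_domains 14 => doms fuel ref ok.
  by have := refuted_sound geo uniqL fuel (isT : valid_rows arc L u [::]) ok; rewrite ref.
have sparse_row i :
    adj_row arc L u i \in [seq T <- choose_bits 14 3 | ~~ nth false T i].
  rewrite mem_filter mem_choose_bits ?size_map ?sum_row // andbT.
  by apply/negP=> /nth_adj_row[_]; apply/negP/geodetic2_irr.
rewrite /initial_domains /valid_doms all_cat all_map; apply/andP; split; last first.
  by apply/allP=> i _; exact: sparse_row.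
(* For labels 0 to 3, the lists given to [row_tree] are what precedes and follows the
   out-neighbourhood in [L]; their lengths are the outer parameters of the blocks. *)
rewrite /= !inE andbT; apply/and4P; split; apply/eqP.
- by rewrite (row_tree 0 [:: u] (N a ++ N b ++ N c ++ [:: z])) ?Nu /= ?size_cat ?sizeN // /L /t -!catA.
- by rewrite (row_tree 1 [:: u; a; b; c] (N b ++ N c ++ [:: z])) ?size_cat ?sizeN //= /L /t -!catA.
- by rewrite (row_tree 2 ([:: u; a; b; c] ++ N a) (N c ++ [:: z])) ?size_cat ?sizeN //= /L /t -!catA //.
- by rewrite (row_tree 3 ([:: u; a; b; c] ++ N a ++ N b) [:: z]) ?size_cat ?sizeN //= /L /t -!catA //.
Qed.
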